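(* Let $T$ be a finite tree with at least two vertices. There is a nonstackable configuration $C$ on $T$ of mass $|C|=\operatorname{estim}(T)-1$ whose score $S_v(C)$ is zero at every vertex $v\in V(T)$.
   Context: Graphs are finite, simple and undirected; a tree is a nonempty connected acyclic graph; $\mathbb N$ includes $0$; $u\sim v$ denotes adjacency. Pebbling. A configuration on $T$ is a function $C:V(T)\to\mathbb N$; its mass is $|C|=\sum_vC(v)$ and its support is $\{v:C(v)>0\}$. A move $u\to v$ is legal when $u\sim v$ and $C(u)\ge 2$; it replaces $C(u)$ by $C(u)-2$ and $C(v)$ by $C(v)+1$. A configuration is reachable from $C$ if it is obtained by a finite (possibly empty) sequence of legal moves. A configuration is stacked at $r$ when its support is exactly $\{r\}$. $C$ is stackable if, for some vertex $r$, a configuration stacked at $r$ is reachable from $C$; otherwise it is nonstackable. Estimator. With $d_T$ the graph distance, put $$\ell_T(r)=|\{v\ne r:\deg_T(v)=1\}|,\qquad \sigma_T(r)=1+\sum_{\substack{v\in V(T)\\ v=r\text{ or }\deg_T(v)>1}}\deg_T(v)\,2^{d_T(r,v)},$$ $$E_T(r)=\sigma_T(r)+\ell_T(r),\qquad \operatorname{estim}(T)=\max_{r\in V(T)}E_T(r).$$ Messages and scores. For adjacent $v,p$ let $B_{v\mid p}$ be the component containing $v$ after deleting the edge $vp$. It is occupied (with respect to $C$) if $C$ is not identically zero on it, and empty otherwise. Define $F:\mathbb Z\to\mathbb Z$ by $F(x)=2x-3$ for $x\le1$; $F(x)=x/2$ for even $x\ge2$; $F(x)=(x-3)/2$ for odd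 $x\ge3$. For an occupied branch $B_{v\mid p}$ define recursively the integer message $$d_{v\to p}=F\Bigl(C(v)+\sum_{\substack{u\sim v,\ u\ne p\\ B_{u\mid v}\text{ occupied}}}d_{u\to v}\Bigr).$$ Put $\bar d_{v\to p}=d_{v\to p}$ if $B_{v\mid p}$ is occupied and $\bar d_{v\to p}=0$ if it is empty. The score at $v$ is $$S_v(C)=C(v)+\sum_{u\sim v}\bar d_{u\to v}.$$ *)

(* Defs.v *)
From HB Require Import structures.
From mathcomp Require Import all_boot all_order all_algebra.

Set Implicit Arguments.
Unset Strict Implicit.
Unset Printing Implicit Defensive.

Import GRing.Theory Num.Theory.

Section Trees.

Variables (T : finType) (e : rel T).

Definition simple_graph : Prop := symmetric e /\ irreflexive e.

Definition connected : Prop := forall x y : T, connect e x y.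

(* Sequences of at most two vertices are excluded: [cycle e [:: x; y]] merely
   traverses an edge back and forth. *)
Definition acyclic : Prop := forall c : seq T, 2 < size c -> ~ ucycle e c.

Definition is_tree : Prop :=
  [/\ simple_graph, 0 < #|T|, connected & acyclic].

Definition deg (v : T) : nat := #|[set u | e v u]|.

(* The least length of a walk from [r] to [v]; it is smaller than [#|T|] when
   [v] is reachable from [r] (and takes the junk value [#|T|] otherwise). *)
Definition dist (r v : T) : nat :=
  find (fun n => [exists p : n.-tuple T, path e r p && (last r p == v)])
       (iota 0 #|T|).

Definition ell (r : T) : nat := #|[set v | (v != r) && (deg v == 1)]|.

Definition sigma (r : T) : nat :=
  1 + \sum_(v | (v == r) || (1 < deg v)) deg v * 2 ^ dist r v.

Definition E (r : T) : nat := sigma r + ell r.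

Definition estim : nat := \max_(r : T) E r.

End Trees.

Section Pebbling.

Variables (T : finType) (e : rel T).

Definition config := {ffun T -> nat}.

Implicit Types (C D : config).

Definition mass C : nat := \sum_v C v.

Definition support C : {set T} := [set v | 0 < C v].

Definition legal C (u v : T) : bool := e u v && (2 <= C u).

(* Legal moves have [u != v], [e] being irreflexive. *)
Definition move C (u v : T) : config :=
  [ffun x => if x == u then C u - 2 else if x == v then C v + 1 else C x].

Inductive reachable C : config -> Prop :=
| reach_refl : reachable C C
| reach_move D u v : reachable C D -> legal D u v -> reachable C (move D u v).

Definition stacked C (r : T) : Prop := support C = [set r].

Definition stackable C : Prop :=
  exists (r : T) (D : config), reachable C D /\ stacked D r.

End Pebbling.

Section Scores.

Local Open Scope ring_scope.

Definition F (x : int) : int :=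
  if x <= 1 then 2 * x - 3
  else if (2 %| x)%Z then (x %/ 2)%Z
  else ((x - 3) %/ 2)%Z.

Variables (T : finType) (e : rel T).

Definition del_edge (v p : T) : rel T :=
  [rel x y | [&& e x y, (x, y) != (v, p) & (x, y) != (p, v)]].

Definition branch (v p : T) : {set T} := [set x | connect (del_edge v p) v x].

Variable C : config T.

Definition occupied (v p : T) : bool := [exists x in branch v p, C x != 0%N].

(* The recursion goes down along strictly decreasing branches, so a recursion
   depth of [#|T|] is enough on a tree: see [messageE] below. *)
Fixpoint message_rec (n : nat) (v p : T) : int :=
  if n is n'.+1 then
    F ((C v)%:Z + \sum_(u | [&& e u v, u != p & occupied u v])
                    message_rec n' u v)
  else 0.

Definition message (v p : T) : int := message_rec #|T| v p.

Definition bar_message (v p : T) : int :=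
  if occupied v p then message v p else 0.

Definition score (v : T) : int :=
  (C v)%:Z + \sum_(u | e u v) bar_message u v.

End Scores.

Section MessageEquation.

Local Open Scope ring_scope.

Variables (T : finType) (e : rel T).
Hypothesis tree_e : is_tree e.

Lemma branch_self v p : v \in branch e v p.
Proof. by rewrite inE connect0. Qed.

Lemma branch_notin u v : e u v -> v \notin branch e u v.
Proof.
case: tree_e => -[sym_e irr_e] _ _ acy euv.
rewrite inE; apply/negP => /connectP[p pth vE].
case: (shortenP pth) vE => q qpth quniq _ vE.
have qe : path e u q.
  by apply: sub_path qpth => x y /= /and3P[].
case: q qpth quniq vE qe => [|x [|y q]].
- by move=> _ _ /= vE; rewrite vE irr_e in euv.
- by move=> /= /andP[/and3P[_ nuv _] _] _ vE; rewrite -vE eqxx in nuv.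
- move=> _ quniq vE qe; apply: (acy (u :: x :: y :: q)) => //.
  rewrite /ucycle /ucycleb quniq andbT.
  by rewrite /cycle rcons_path qe -vE sym_e euv.
Qed.

Lemma branch_proper u v p :
  e v p -> e u v -> u != p -> branch e u v \proper branch e v p.
Proof.
case: (tree_e) => -[sym_e irr_e] _ _ _ evp euv up.
have nv := branch_notin euv.
apply/properP; split; last by exists v; rewrite ?branch_self.
apply/subsetP => x; rewrite !inE => /connectP[s pth ->].
have vu : connect (del_edge e v p) v u.
  apply: connect1; rewrite /del_edge /= sym_e euv !xpair_eqE negb_and up orbT /=.
  rewrite negb_and; apply/orP; left; apply/eqP => vp.
  by rewrite vp irr_e in evp.
apply: connect_trans vu _.
elim/last_ind: s pth => [|s y IHs]; first by rewrite connect0.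
rewrite last_rcons rcons_path => /andP[pth ey].
apply: connect_trans (IHs pth) (connect1 _).
have su : last u s \in branch e u v by rewrite inE; apply/connectP; exists s.
have yu : y \in branch e u v.
  rewrite inE; apply: connect_trans (connect1 ey).
  by apply/connectP; exists s.
case/and3P: ey => ey _ _; rewrite /del_edge /= ey !xpair_eqE /=.
apply/andP; split; rewrite negb_and.
  by apply/orP; left; apply: contraNneq nv => vE; rewrite -{1}vE.
by apply/orP; right; apply: contraNneq nv => vE; rewrite -{1}vE.
Qed.

Lemma message_rec_stable C n m v p :
    e v p -> (#|branch e v p| <= n)%N -> (#|branch e v p| <= m)%N ->
  message_rec e C n v p = message_rec e C m v p.
Proof.
have b_gt0 w q : (0 < #|branch e w q|)%N.
  by apply/card_gt0P; exists w; apply: branch_self.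
elim: n m v p => [|n IHn] [|m] v p evp //=.
- by rewrite leqNgt b_gt0.
- by move=> _; rewrite leqNgt b_gt0.
move=> le_n le_m; congr (F (_ + _)); apply: eq_bigr => u /and3P[euv up _].
have lt_b := proper_card (branch_proper evp euv up).
by apply: IHn; rewrite // -ltnS (leq_trans lt_b).
Qed.

Theorem messageE C v p : e v p ->
  message e C v p =
    F ((C v)%:Z + \sum_(u | [&& e u v, u != p & occupied e C u v])
                    message e C u v).
Proof.
move=> evp; rewrite {1}/message.
rewrite (@message_rec_stable C _ #|T|.+1) ?max_card ?leqW ?max_card //.
Qed.

End MessageEquation.

(* Main.v *)
Require Import Defs.
From mathcomp Require Import all_boot all_order all_algebra.
From mathcomp Require Import zify.

Set Implicit Arguments.
Unset Strict Implicit.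
Unset Printing Implicit Defensive.

(** The message from [v] to [p] measures how many pebbles the branch of [v]
    can deliver at [p], a negative value being a demand, and the score at [v]
    balances these contributions.  Two independent facts give the theorem.

    Scores never increase.  The number [F x] of pebbles delivered is not a
    monotone function of the supply [x] (for example [F 2 > F 3]), but it is
    monotone for the finer order [le3], in which [y] is below [x] when [x - y]
    is a nonnegative multiple of 3.  In that order, removing two pebbles from
    the supply lowers the message by at least one ([F_sub2]), and adding one
    pebble raises it by at most two ([F_add1]).  These are exactly the
    exchange rates of a move from [a] to [b]: the two pebbles that leave [a]
    pay for the better message from [b], and the pebble that arrives at [b] is
    paid for by the worse message from [a].  Every other message can only
    drop ([bar_message_move]), hence so does every score ([score_move]).  A
    configuration stacked at [r] has the positive score [C r] at [r], so a
    configuration with no positive score is nonstackable ([nonstackable]).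

    The extremal configuration.  Let [r] maximize [E e r].  Put one pebble on
    every leaf other than [r], [sigma e r - 1] pebbles on [r], and none
    elsewhere; the mass is [E e r - 1] by definition.  Orient the edges
    toward [r].  A leaf sends the message -1, and an inner vertex whose
    children demand [K] pebbles in total sends [F (- K) = - (2 * K + 3)].
    Solving this recursion shows that the neighbours of [r] demand precisely
    [sigma e r - 1] pebbles ([sigma_excess]), so the score at [r] is 0.  Away
    from the root, if the score at the parent [p] of [v] is 0, then the supply
    of [p] seen from [v] is the demand of [v]; the answer of [p] is
    [F (2 * K + 3) = K] when [v] is an inner vertex, which meets the demand of
    its children, and [F 1 = -1] when [v] is a leaf, which cancels its pebble.
    So all scores vanish ([extremal_score0]). *)

(** * The order modulo 3 and the function F *)

Section Steps.

Import Order.TTheory GRing.Theory Num.Theory.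
Local Open Scope ring_scope.

(** The plain order would not do: [F] takes the values 1, 0, 2, 1, 3, 2, ...
    at 2, 3, 4, 5, 6, 7, ..., so it decreases at every other step. *)
Definition le3 (y x : int) : Prop := exists k : nat, x = y + (3 * k)%:Z.

Lemma le3_refl x : le3 x x.
Proof. by exists 0%N; lia. Qed.

Lemma le3_trans y x z : le3 x y -> le3 y z -> le3 x z.
Proof. by move=> [k ->] [l ->]; exists (k + l)%N; lia. Qed.

Lemma le3_add y1 x1 y2 x2 : le3 y1 x1 -> le3 y2 x2 -> le3 (y1 + y2) (x1 + x2).
Proof. by move=> [k ->] [l ->]; exists (k + l)%N; lia. Qed.

Lemma le3_le y x : le3 y x -> y <= x.
Proof. by case=> k ->; lia. Qed.

Lemma le3_sum (I : finType) (P : pred I) (f g : I -> int) :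
    (forall i, P i -> le3 (f i) (g i)) ->
  le3 (\sum_(i | P i) f i) (\sum_(i | P i) g i).
Proof.
move=> le_fg; elim/big_ind2: _ => //; first exact: le3_refl.
by move=> *; apply: le3_add.
Qed.

Lemma F_small x : x <= 1 -> F x = 2 * x - 3.
Proof. by rewrite /F => ->. Qed.

Lemma F_odd (n : nat) : F (2 * n + 3)%:Z = n.
Proof. by rewrite /F; do ! case: ifP; lia. Qed.

(** Two pebbles of supply are worth one delivered pebble; when [x <= 2] the
    remaining supply falls in the part of slope 2, and the loss is 4 instead
    of 1. *)
Lemma F_sub2 x : le3 (F (x - 2)) (F x - 1).
Proof.
suff: F x = F (x - 2) + 1 \/ F x = F (x - 2) + 4.
  by case=> ->; [exists 0%N | exists 1%N]; lia.
by rewrite /F; do ! case: ifP; lia.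
Qed.

(** One more pebble saves at most the cost of two for fetching it; an even
    positive supply becomes odd and does worse by 3. *)
Lemma F_add1 y : le3 (F (y + 1)) (F y + 2).
Proof.
suff: F y = F (y + 1) - 2 \/ F y = F (y + 1) + 1.
  by case=> ->; [exists 0%N | exists 1%N]; lia.
by rewrite /F; do ! case: ifP; lia.
Qed.

(** Three pebbles change the parity, so the two rules [x / 2] and [(x - 3) / 2]
    alternate along steps of 3, and the increments are 0 or 3 (6 on the part
    of slope 2). *)
Lemma F_le3 y x : le3 y x -> le3 (F y) (F x).
Proof.
case=> k ->; elim: k => [|k IHk]; first by rewrite addr0; apply: le3_refl.
apply: le3_trans IHk _; set z := (y + _).
have -> : y + (3 * k.+1)%:Z = z + 3 by lia.
suff: F (z + 3) = F z \/ F (z + 3) = F z + 3 \/ F (z + 3) = F z + 6.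
  by case=> [|[]] ->; [exists 0%N | exists 1%N | exists 2%N]; lia.
by rewrite /F; do ! case: ifP; lia.
Qed.

End Steps.

(** * Branches of a tree *)

Section Branches.

Variables (T : finType) (e : rel T).
Hypothesis tree_e : is_tree e.

Lemma edge_sym : symmetric e.
Proof. by case: tree_e => -[]. Qed.

Lemma edge_neq u v : e u v -> u != v.
Proof.
case: tree_e => -[_ irr_e] _ _ _; apply: contraTneq => ->.
by rewrite irr_e.
Qed.

Lemma del_edge_sym v p : symmetric (del_edge e v p).
Proof.
move=> x y; rewrite /del_edge /= edge_sym !xpair_eqE.
by congr (_ && _); rewrite andbC (andbC (y == v)) (andbC (y == p)).
Qed.

Lemma connect_del_edge_sym v p : connect_sym (del_edge e v p).
Proof. by apply: sym_connect_sym; apply: del_edge_sym. Qed.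

Lemma del_edgeC v p : del_edge e v p =2 del_edge e p v.
Proof. by move=> x y; rewrite /del_edge /=; congr (_ && _); rewrite andbC. Qed.

(** Both ends of an edge other than [vp] lie in the same component once [vp] is
    deleted, so a move changes the occupation of at most the two branches at its
    own edge. *)
Lemma branch_step a b v p :
    e a b -> (v, p) != (a, b) -> (v, p) != (b, a) ->
  (a \in branch e v p) = (b \in branch e v p).
Proof.
move=> eab nab nba; rewrite !inE !(connect_del_edge_sym v p v).
apply: (same_connect (connect_del_edge_sym v p)).
apply: connect1; rewrite /del_edge /= eab !xpair_eqE /=.
move: nab nba; rewrite !xpair_eqE ![_ == v]eq_sym ![_ == p]eq_sym.
by rewrite (andbC (p == a)) => -> ->.
Qed.

Lemma branch_disjoint v p x :
  e v p -> x \in branch e v p -> x \notin branch e p v.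
Proof.
move=> evp xv; apply: contra (branch_notin tree_e evp) => xp.
move: xv xp; rewrite !inE (eq_connect (del_edgeC p v)) => xv xp.
by apply: connect_trans xv _; rewrite connect_del_edge_sym.
Qed.

(** Messages are defined by recursion on branches, and this is the matching
    induction principle. *)
Lemma branch_ind (P : T -> T -> Prop) :
    (forall v p, e v p -> (forall u, e u v -> u != p -> P u v) -> P v p) ->
  forall v p, e v p -> P v p.
Proof.
move=> IH v p; have [n] := ubnP #|branch e v p|.
elim: n v p => // n IHn v p lt_n evp; apply: IH => // u euv up.
apply: IHn => //; rewrite -ltnS; apply: leq_trans lt_n.
by rewrite ltnS proper_card // branch_proper.
Qed.

End Branches.

(** * Moves never increase scores *)

Section Moves.

Import Order.TTheory GRing.Theory Num.Theory.
Local Open Scope ring_scope.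

Variables (T : finType) (e : rel T).
Hypothesis tree_e : is_tree e.

Implicit Types C D : config T.

(** The common shape of scores ([Q] holds everywhere) and of the arguments of
    [F] in messages ([Q] excludes the recipient), so that the effect of a move
    is computed once. *)
Definition inflow (C : config T) (v : T) (Q : pred T) : int :=
  (C v)%:Z + \sum_(u | e u v && Q u) bar_message e C u v.

Lemma scoreE C v : score e C v = inflow C v predT.
Proof.
rewrite /score /inflow; congr (_ + _); apply: eq_bigl => u.
by rewrite andbT.
Qed.

Lemma message_inflow C v p :
  e v p -> message e C v p = F (inflow C v (predC1 p)).
Proof.
move=> evp; rewrite (messageE tree_e) //; congr (F (_ + _)).
rewrite /bar_message -big_mkcondr; apply: eq_bigl => u /=.
by rewrite andbA.
Qed.

Lemma bar_messageE C v p : e v p ->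
  bar_message e C v p =
    if occupied e C v p then F (inflow C v (predC1 p)) else 0.
Proof. by move=> evp; rewrite /bar_message message_inflow. Qed.

(** When a move empties a branch or enters an empty one, the message jumps to or
    from the conventional value 0; this gives the other value. *)
Lemma inflow_empty C v p :
    e v p -> (forall x, x \in branch e v p -> x != v -> C x = 0%N) ->
  inflow C v (predC1 p) = C v.
Proof.
move=> evp C0; rewrite /inflow big1 ?addr0 // => u /andP[euv /= up].
rewrite /bar_message; case: ifP => // /existsP[x /andP[xu]].
have xv : x \in branch e v p.
  by apply: subsetP xu; apply: proper_sub; apply: branch_proper.
rewrite C0 ?eqxx //; apply: contraTneq xu => ->.
exact: branch_notin.
Qed.

Section OneMove.

Variables (C : config T) (a b : T).
Hypothesis legal_ab : legal e C a b.

Let eab : e a b. Proof. by case/andP: legal_ab. Qed.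
Let eba : e b a. Proof. by rewrite (edge_sym tree_e). Qed.
Let ab : a != b. Proof. exact: (edge_neq tree_e). Qed.
Let Ca : (2 <= C a)%N. Proof. by case/andP: legal_ab. Qed.
Let D := move C a b.

Let Da : D a = (C a - 2)%N. Proof. by rewrite ffunE eqxx. Qed.
Let Db : D b = (C b + 1)%N.
Proof. by rewrite ffunE eq_sym (negPf ab) eqxx. Qed.
Let DE x : x != a -> x != b -> D x = C x.
Proof. by move=> xa xb; rewrite ffunE (negPf xa) (negPf xb). Qed.

(** How much a move from [a] to [b] may improve the message from [v] to [p]:
    it improves at most the message sent against the move, by the two pebbles
    that [a] has spent. *)
Let gain (v p : T) : int :=
  if (v, p) == (a, b) then - 1 else if (v, p) == (b, a) then 2 else 0.

(** The change of the pile at [v] and the changes of the messages cancel at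
    both ends of the move: [- 2 + 2] at [a] and [1 - 1] at [b], provided that
    the message from the other end is counted. *)
Lemma inflow_move v (Q : pred T) :
    (forall u, e u v -> Q u ->
       le3 (bar_message e D u v) (bar_message e C u v + gain u v)) ->
  [/\ v = a -> ~~ Q b -> le3 (inflow D v Q) (inflow C v Q - 2),
      v = b -> ~~ Q a -> le3 (inflow D v Q) (inflow C v Q + 1)
    & (v = a -> Q b) -> (v = b -> Q a) ->
        le3 (inflow D v Q) (inflow C v Q)].
Proof.
move=> IH.
have {}IH : le3 (inflow D v Q) (inflow C v Q + (((D v)%:Z - (C v)%:Z)
      + \sum_(u | e u v && Q u) gain u v)).
  rewrite (_ : _ + _ = (D v)%:Z
      + \sum_(u | e u v && Q u) (bar_message e C u v + gain u v)).
    apply: le3_add (le3_refl _) _; apply: le3_sum => u /andP[euv Qu].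
    exact: IH.
  by rewrite big_split /= /inflow addrACA (addrC (C v)%:Z) subrK.
have gainE u : gain u v = (if (u, v) == (a, b) then - 1 else 0)
                        + (if (u, v) == (b, a) then 2 else 0).
  rewrite /gain; case: eqP => [[-> ->]|_]; last by rewrite add0r.
  by rewrite xpair_eqE (negPf ab).
have sumE x y k : e x y -> \sum_(u | e u v && Q u)
     (if (u, v) == (x, y) then k else 0 : int)
     = if (v == y) && Q x then k else 0.
  move=> exy; rewrite -big_mkcondr /=.
  case: eqP => [->|vy] /=; last first.
    by rewrite big1 // => u /andP[_ /eqP[]].
  case: ifP => Qx; last first.
    by rewrite big1 // => u /andP[/andP[_ Qu] /eqP[ux]]; rewrite ux Qx in Qu.
  rewrite (big_pred1 x) // => u /=; rewrite xpair_eqE eqxx andbT.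
  by case: (u =P x) => [->|]; rewrite ?andbF // exy Qx.
move: IH; rewrite (eq_bigr _ (fun u _ => gainE u)) big_split /=.
rewrite !sumE //; move: (inflow D v Q) (inflow C v Q) => y x.
have -> : (D v)%:Z - (C v)%:Z
        = (if v == a then - 2 else if v == b then 1 else 0).
  case: eqP => [->|/eqP va]; first by rewrite Da; lia.
  by case: eqP => [->|/eqP vb]; [rewrite Db; lia|rewrite DE // subrr].
have nab : a <> b by apply/eqP.
have nba : b <> a by move/esym.
case: (v =P a) => [->|va]; rewrite ?(introF eqP nab) /=.
  case: (Q b) => -[k Ek]; split; try by [move/nab | move=> _ /(_ erefl)].
  - by [].
  - by move=> _ _; exists k; lia.
  - by move=> _ _; exists k; lia.
  - by move/(_ erefl).
case: (v =P b) => [->|vb] /=.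
  case: (Q a) => -[k Ek]; split; try by [move/nba | move=> _ /(_ erefl)].
  - by [].
  - by move=> _ _; exists k; lia.
  - by move=> _ _; exists k; lia.
by rewrite !addr0.
Qed.

(** Inside a branch that lies on one side of the move nothing improves, and on
    the edge [ab] the estimates [F_sub2] and [F_add1] apply.  The occupation
    of a branch can change only on that edge, and there the conventional value
    0 of an empty branch obeys the same bounds. *)
Lemma bar_message_move v p :
  e v p -> le3 (bar_message e D v p) (bar_message e C v p + gain v p).
Proof.
move: v p; apply: (branch_ind tree_e) => v p evp IH.
have [Iab Iba Inone] := inflow_move (Q := predC1 p) IH.
rewrite !bar_messageE // /gain.
case: eqP => [[va pb]|/eqP vp_ab]; [|case: eqP => [[vb pa]|/eqP vp_ba]].
- rewrite {}va {}pb /= in evp IH Iab Iba Inone *.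
  have -> : occupied e C a b.
    by apply/existsP; exists a; rewrite branch_self -lt0n (leq_trans _ Ca).
  case: ifPn => [occ|/existsPn empty].
    apply: le3_trans (F_le3 _) (F_sub2 _).
    by apply: Iab; rewrite //= eqxx.
  (* The move empties the branch, so it consisted of two pebbles at [a], and
     its message [F 2 = 1] is replaced by 0. *)
  have C0 x : x \in branch e a b -> D x = 0%N.
    by move=> xa; apply/eqP; move: (empty x); rewrite xa /= negbK.
  have Ca2 : C a = 2%N.
    by move: (C0 a (branch_self _ _ _)); rewrite Da; lia.
  rewrite inflow_empty // => [|x xa nxa]; first by rewrite Ca2; exists 0%N.
  rewrite -DE // ?C0 //; apply: contraTneq xa => ->; exact: branch_notin.
- rewrite {}vb {}pa /= in evp IH Iab Iba Inone *.
  have -> : occupied e D b a.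
    by apply/existsP; exists b; rewrite branch_self Db addn1.
  have {Iba}/F_le3 leF :
      le3 (inflow D b (predC1 a)) (inflow C b (predC1 a) + 1).
    by apply: Iba; rewrite //= eqxx.
  case: ifPn => [occ|/existsPn empty]; first exact: le3_trans leF (F_add1 _).
  (* The branch was empty: its message 0 is replaced by [F 1 = -1]. *)
  have C0 x : x \in branch e b a -> C x = 0%N.
    by move=> xb; apply/eqP; move: (empty x); rewrite xb /= negbK.
  apply: le3_trans leF _; rewrite inflow_empty // => [|x xb _]; last exact: C0.
  by rewrite C0 ?branch_self //; exists 1%N.
rewrite addr0; have same_occ : occupied e D v p = occupied e C v p.
  have [a_in|a_out] := boolP (a \in branch e v p).
    have b_in : b \in branch e v p by rewrite -(branch_step tree_e eab).
    transitivity true; first by apply/existsP; exists b; rewrite b_in Db addn1.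
    by apply/esym/existsP; exists a; rewrite a_in -lt0n (leq_trans _ Ca).
  have b_out : b \notin branch e v p by rewrite -(branch_step tree_e eab).
  apply: eq_existsb => x; case x_in: (x \in _) => //=; rewrite DE //.
    by apply: contraNneq a_out => <-.
  by apply: contraNneq b_out => <-.
rewrite same_occ; case: ifP => _; last exact: le3_refl.
apply/F_le3/Inone => [va|vb] /=.
  by apply: contraNneq vp_ab => <-; rewrite va.
by apply: contraNneq vp_ba => <-; rewrite vb.
Qed.

Lemma score_move v : score e D v <= score e C v.
Proof.
rewrite !scoreE; apply: le3_le.
have IH u : e u v -> predT u ->
    le3 (bar_message e D u v) (bar_message e C u v + gain u v).
  by move=> euv _; apply: bar_message_move.
by have [_ _] := inflow_move IH; apply.
Qed.

End OneMove.

Lemma score_reachable C D v : reachable e C D -> score e D v <= score e C v.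
Proof.
elim=> // {}D a b _ IH legal_ab.
exact: le_trans (score_move legal_ab v) IH.
Qed.

(** All branches at [r] are empty, so nothing is added to the pile. *)
Lemma score_stacked D r : stacked D r -> score e D r = D r.
Proof.
move=> st; rewrite /score big1 ?addr0 // => u eur.
rewrite /bar_message; case: ifP => // /existsP[x /andP[xu]].
rewrite -lt0n => Dx; have : x \in Defs.support D by rewrite inE.
rewrite st inE => /eqP xr; rewrite xr in xu.
by have := branch_notin tree_e eur; rewrite xu.
Qed.

Lemma nonstackable C : (forall v, score e C v <= 0) -> ~ stackable e C.
Proof.
move=> C0 [r [D [CD st]]].
have : r \in Defs.support D by rewrite st inE.
rewrite inE => Dr; have := score_reachable r CD.
rewrite score_stacked //; move: (C0 r); lia.
Qed.

End Moves.

(** * Rooted trees *)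

Section RootedTree.

Variables (T : finType) (e : rel T).
Hypothesis tree_e : is_tree e.
Variable r : T.

Lemma dist_le_path q : path e r q -> dist e r (last r q) <= size q.
Proof.
move=> pq; rewrite leqNgt; apply/negP => lt_q.
have lt_qT : size q < #|T|.
  by apply: leq_trans lt_q _; rewrite -[X in _ <= X](size_iota 0) find_size.
move: (before_find 0 lt_q); rewrite nth_iota // => /existsP[].
by exists (in_tuple q); rewrite pq eqxx.
Qed.

(** Shortening a walk of least length keeps the length, so a geodesic may be
    taken simple; simplicity is what locates it inside a branch. *)
Lemma dist_path v :
  exists2 q, path e r q /\ uniq (r :: q) & last r q = v /\ size q = dist e r v.
Proof.
have shorten_to q : path e r q -> last r q = v ->
    exists2 q', path e r q' /\ uniq (r :: q')
              & last r q' = v /\ size q' <= size q.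
  move=> pq; case: (shortenP pq) => q' pq' uq' sub lq'.
  exists q'; split=> //; apply: uniq_leq_size sub; by case/andP: uq'.
case: (tree_e) => _ _ /(_ r v)/connectP[q pq vE] _.
have [{pq vE}q [pq uq] [lq _]] := shorten_to q pq (esym vE).
have lt_q : size q < #|T|.
  by rewrite -[_.+1]/(size (r :: q)) -(card_uniqP uq) max_card.
have : has (fun n => [exists p : n.-tuple T, path e r p && (last r p == v)])
           (iota 0 #|T|).
  apply/hasP; exists (size q); first by rewrite mem_iota.
  by apply/existsP; exists (in_tuple q); rewrite pq lq eqxx.
move=> hasd; have := nth_find 0 hasd; rewrite nth_iota; last first.
  by move: hasd; rewrite has_find size_iota.
move=> /existsP[w /andP[pw /eqP lw]].
have [q' [pq' uq'] [lq' le_q']] := shorten_to w pw lw.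
exists q' => //; split=> //; apply/eqP; rewrite eqn_leq -{2}lq' dist_le_path //.
by rewrite size_tuple in le_q'; rewrite le_q'.
Qed.

Lemma dist_root : dist e r r = 0.
Proof. by apply/eqP; rewrite -leqn0; apply: (@dist_le_path [::]). Qed.

(** The parent relation of the tree rooted at [r], expressed with branches so
    that the inclusions and disjointness of branches apply to it directly. *)
Definition toward (v p : T) : bool := e v p && (r \in branch e p v).

Lemma toward_edge v p : toward v p -> e v p.
Proof. by case/andP. Qed.

Lemma toward_root u : toward u r = e u r.
Proof. by rewrite /toward branch_self andbT. Qed.

Lemma root_not_toward p : toward r p = false.
Proof.
apply: negbTE; apply/negP => /andP[erp].
by apply/negP/branch_notin; rewrite // (edge_sym tree_e).
Qed.

(** The branch of the parent side contains [r] and is included in the branch of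
    [v] seen from any other neighbour [u], so [v] is the parent of [u]. *)
Lemma toward_children v p u :
  toward v p -> toward u v = e u v && (u != p).
Proof.
case/andP=> evp rp; rewrite /toward; case euv: (e u v) => //=.
have epv : e p v by rewrite (edge_sym tree_e).
have evu : e v u by rewrite (edge_sym tree_e).
have [->|up] := eqVneq u p.
  by apply: negbTE; apply: branch_disjoint rp.
apply: subsetP rp; apply: proper_sub; apply: branch_proper => //.
by rewrite eq_sym.
Qed.

Lemma toward_uniq v p q : toward v p -> toward v q -> q = p.
Proof.
move=> vp vq; have eqv : e q v by rewrite (edge_sym tree_e) toward_edge.
apply/eqP; apply/negPn/negP => qp.
have := toward_children q vp; rewrite eqv qp /toward eqv /= => rv.
case/andP: vq => evq rq; have := branch_disjoint tree_e eqv rq.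
by rewrite rv.
Qed.

(** The last step of a simple geodesic from [r] to [v] starts at the parent:
    the rest of the geodesic avoids [v], hence survives the deletion of that
    step. *)
Lemma toward_ex v :
  v != r -> exists2 p, toward v p & dist e r v = (dist e r p).+1.
Proof.
move=> vr; have [q [pq uq] [lq sq]] := dist_path v.
case/lastP: q => [|q w] in pq uq lq sq *; first by rewrite -lq eqxx in vr.
rewrite last_rcons in lq; rewrite {w}lq rcons_path size_rcons in pq uq sq.
case/andP: pq => pq epv; set p := last r q in epv.
move: uq; rewrite -rcons_cons rcons_uniq => /andP[v_notin _].
exists p.
  rewrite /toward (edge_sym tree_e) epv inE (connect_del_edge_sym tree_e).
  apply/connectP; exists q => //.
  apply: (@sub_in_path _ (predC1 v) e) pq; last first.
    by apply/allP => x xq /=; apply: contraNneq v_notin => <-.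
  move=> x y /= xv yv exy; rewrite /del_edge /= exy !xpair_eqE.
  by rewrite (negPf xv) (negPf yv) andbF.
apply/eqP; rewrite eqn_leq -{2}sq ltnS dist_le_path // andbT.
have [q' [pq' _] [lq' <-]] := dist_path p.
have := @dist_le_path (rcons q' v).
by rewrite rcons_path pq' lq' epv last_rcons size_rcons; apply.
Qed.

Lemma dist_toward v p : toward v p -> dist e r v = (dist e r p).+1.
Proof.
move=> vp; have vr : v != r.
  by apply: contraTneq vp => ->; rewrite root_not_toward.
by have [q vq ->] := toward_ex vr; rewrite (toward_uniq vp vq).
Qed.

Lemma sum_children (g : T -> nat) :
  \sum_v \sum_(u | toward u v) g u = \sum_(v | v != r) g v.
Proof.
rewrite (exchange_big_dep predT) //= [RHS]big_mkcond /=.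
apply: eq_bigr => u _; case: eqP => [->|/eqP /toward_ex[p up _]] /=.
  by rewrite big1 // => v; rewrite root_not_toward.
rewrite (big_pred1 p) // => v; apply/idP/eqP => [|-> //].
exact: toward_uniq up.
Qed.

Lemma deg_children v p : toward v p -> deg e v = (\sum_(u | toward u v) 1).+1.
Proof.
move=> vp; rewrite /deg (cardsD1 p) inE (toward_edge vp) add1n; congr _.+1.
rewrite sum1_card; apply: eq_card => u.
rewrite !inE (edge_sym tree_e) andbC; exact/esym/toward_children.
Qed.

Lemma deg_root : deg e r = \sum_(u | toward u r) 1.
Proof.
rewrite sum1_card /deg; apply: eq_card => u; rewrite !inE (edge_sym tree_e).
exact/esym/toward_root.
Qed.

(** Unrolling the recursion from the root: weighting the equation at [v] by
    [2 ^ dist e r v], the factor 2 in front of the children becomes their own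
    weight, and all terms cancel except the constants and the contribution of
    the children of [r]. *)
Lemma telescope (h c : T -> nat) :
    (forall v, v != r -> h v = c v + 2 * \sum_(u | toward u v) h u) ->
  2 * \sum_(u | toward u r) h u = \sum_(v | v != r) c v * 2 ^ dist e r v.
Proof.
move=> hE; have := sum_children (fun v => h v * 2 ^ dist e r v).
pose H v := \sum_(u | toward u v) h u.
rewrite (eq_bigr (fun v => 2 * H v * 2 ^ dist e r v)); last first.
  move=> v _; rewrite -mulnA mulnCA /H big_distrl /=.
  apply: eq_bigr => u uv; rewrite (dist_toward uv) expnS; lia.
rewrite (bigD1 r) //= dist_root expn0 muln1.
rewrite [RHS](eq_bigr (fun v => c v * 2 ^ dist e r v
                              + 2 * H v * 2 ^ dist e r v)).
  rewrite big_split /= /H; lia.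
by move=> v vr; rewrite hE // mulnDl.
Qed.

End RootedTree.

(** * A configuration with zero scores *)

Section ExtremalConfiguration.

Variables (T : finType) (e : rel T).
Hypotheses (tree_e : is_tree e) (card_T : 2 <= #|T|).
Variable r : T.

Definition extremal : config T :=
  [ffun v => if v == r then (sigma e r).-1 else (deg e v == 1 : nat)].

Local Notation C := extremal.

Lemma extremal_root : C r = (sigma e r).-1.
Proof. by rewrite ffunE eqxx. Qed.

Lemma extremal_off v : v != r -> C v = (deg e v == 1).
Proof. by move=> vr; rewrite ffunE (negPf vr). Qed.

Lemma mass_extremal : mass C = E e r - 1.
Proof.
rewrite /mass (bigD1 r) //= extremal_root /E /ell.
rewrite (eq_bigr (fun v => deg e v == 1 : nat)); last exact: extremal_off.
by rewrite -big_mkcondr sum1dep_card /sigma add1n addSn subn1.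
Qed.

Lemma deg_gt0 v : 0 < deg e v.
Proof.
have /card_gt0P[w] : 0 < #|predC1 v|.
  by rewrite cardC1 -subn1 subn_gt0.
rewrite inE => wv; case: (tree_e) => _ _ conn _.
have /connectP[[|x q] /= pq wE] := conn v w.
  by rewrite wE eqxx in wv.
by case/andP: pq => evx _; apply/card_gt0P; exists x; rewrite inE.
Qed.

Lemma extremal_root_gt0 : 0 < C r.
Proof.
rewrite extremal_root /sigma add1n /= (bigD1 r) ?eqxx //=.
by rewrite addn_gt0 muln_gt0 deg_gt0 expn_gt0.
Qed.

(** Every branch contains [r] or a leaf of the tree, so that no message takes
    the conventional value for empty branches. *)
Lemma extremal_occupied v p : e v p -> occupied e C v p.
Proof.
move: v p; apply: (branch_ind tree_e) => v p evp IH.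
have [Cv|] := boolP (0 < C v).
  by apply/existsP; exists v; rewrite branch_self -lt0n.
have [->|vr] := eqVneq v r; first by rewrite extremal_root_gt0.
rewrite extremal_off // -eqn0Ngt; case: eqP => // deg1 _.
have /card_gt0P[u] : 0 < #|[set u | e v u] :\ p|.
  have := cardsD1 p [set u | e v u]; rewrite inE evp.
  by case: #|_ :\ _| => //; move: deg1; rewrite /deg => + E; rewrite E.
rewrite !inE => /andP[up evu].
have euv : e u v by rewrite (edge_sym tree_e).
have /existsP[x /andP[xu Cx]] := IH u euv up.
apply/existsP; exists x; rewrite Cx andbT.
by apply: subsetP xu; apply: proper_sub; apply: branch_proper.
Qed.

Import Order.TTheory GRing.Theory Num.Theory.
Local Open Scope ring_scope.

Local Notation msg := (message e C).
Local Notation toward := (toward e r).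

Lemma extremal_score v : score e C v = (C v)%:Z + \sum_(u | e u v) msg u v.
Proof.
rewrite /score; congr (_ + _); apply: eq_bigr => u euv.
by rewrite /bar_message extremal_occupied.
Qed.

Lemma extremal_message v p : e v p ->
  msg v p = F ((C v)%:Z + \sum_(u | e u v && (u != p)) msg u v).
Proof.
move=> evp; rewrite (messageE tree_e) //; congr (F (_ + _)).
apply: eq_bigl => u; case euv: (e u v) => //=.
by rewrite extremal_occupied // andbT.
Qed.

Definition parent (v : T) : T := odflt v [pick p | toward v p].

Lemma parentP v p : toward v p -> parent v = p.
Proof.
move=> vp; rewrite /parent; case: pickP => [q vq|/(_ p)]; last by rewrite vp.
exact: (toward_uniq tree_e vp vq).
Qed.

(** One less than the demand [- msg v (parent v)].  The shift by one makes the
    recursion of the demands into that of [telescope], with the constant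
    [2 * deg e v] at inner vertices and 0 at leaves ([excess_rec]), which are
    the terms of [sigma]. *)
Definition excess (v : T) : nat := absz (msg v (parent v) + 1).

Lemma extremal_message_up v p : toward v p ->
  msg v p = F ((deg e v == 1%N)%:Z + \sum_(u | toward u v) msg u v).
Proof.
move=> vp; rewrite extremal_message ?(toward_edge vp) //.
rewrite extremal_off; last first.
  by apply: contraTneq vp => ->; rewrite root_not_toward.
congr (F (_ + _)); apply: eq_bigl => u.
by rewrite (toward_children tree_e u vp).
Qed.

Lemma toward_leaf v p u : toward v p -> deg e v = 1%N -> toward u v = false.
Proof.
move=> vp; rewrite (deg_children tree_e vp) => -[] /eqP.
by rewrite sum_nat_eq0 => /forallP/(_ u); case: toward.
Qed.

(** Only the sign matters here: it keeps the argument of [F] in the linear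
    range [x <= 1] and makes [excess] a natural number. *)
Lemma message_up_lt0 v p : toward v p -> msg v p <= - 1.
Proof.
move=> vp; have evp := toward_edge vp; move: v p evp vp.
apply: (branch_ind tree_e) => v p evp IH vp; rewrite extremal_message_up //.
have [deg1|deg_neq1] := eqVneq (deg e v) 1%N.
  by rewrite big1 // => u; rewrite (toward_leaf _ vp).
suff sum_le0 : \sum_(u | toward u v) msg u v <= 0.
  by rewrite add0r F_small; lia.
apply: sumr_le0 => u uv; apply: le_trans (IH u _ _ uv) _ => //.
  exact: toward_edge uv.
by move: uv; rewrite (toward_children tree_e u vp) => /andP[].
Qed.

Lemma message_upE v p : toward v p -> msg v p = - (excess v).+1%:Z.
Proof.
move=> vp; rewrite /excess (parentP vp).
have := message_up_lt0 vp; move: (msg v p) => m; lia.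
Qed.

Lemma sum_message_up v :
  \sum_(u | toward u v) msg u v = - (\sum_(u | toward u v) (excess u).+1)%N%:Z.
Proof.
rewrite (big_morph Posz PoszD (erefl _)) -sumrN.
by apply: eq_bigr => u /message_upE.
Qed.

Lemma sum_excessS v : (\sum_(u | toward u v) (excess u).+1
  = \sum_(u | toward u v) excess u + \sum_(u | toward u v) 1)%N.
Proof. by rewrite -big_split /=; apply: eq_bigr => u _; rewrite addn1. Qed.

Lemma excess_leaf v p : toward v p -> deg e v = 1%N -> excess v = 0%N.
Proof.
move=> vp deg1; have := message_upE vp; rewrite extremal_message_up // deg1.
rewrite big1 => [|u]; last by rewrite (toward_leaf _ vp).
rewrite (_ : F _ = - 1) //; lia.
Qed.

Lemma excess_inner v p : toward v p -> deg e v != 1%N ->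
  (excess v).+1 = (2 * \sum_(u | toward u v) (excess u).+1 + 3)%N.
Proof.
move=> vp deg_neq1; have := message_upE vp; rewrite extremal_message_up //.
rewrite (negPf deg_neq1) sum_message_up add0r.
move: (\sum_(u | _) _)%N => K; rewrite F_small; lia.
Qed.

(** At an inner vertex the demand is [2 * K + 3], with [K] the sum of the
    demands of its [deg e v - 1] children; subtracting one from each demand
    turns this into [2 * deg e v] plus twice the sum of the excesses. *)
Lemma excess_rec v : v != r ->
  (excess v = (if 1 < deg e v then 2 * deg e v else 0)
              + 2 * \sum_(u | toward u v) excess u)%N.
Proof.
move=> /(toward_ex tree_e)[p vp _].
have [deg1|deg_neq1] := eqVneq (deg e v) 1%N.
  rewrite (excess_leaf vp deg1) deg1 big1 // => u.
  by rewrite (toward_leaf _ vp).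
have := excess_inner vp deg_neq1; rewrite sum_excessS.
have := deg_children tree_e vp.
move: deg_neq1; case: ifP; lia.
Qed.

(** The neighbours of [r] contribute [deg e r] through the shifts by one, and
    their excesses add up to the remaining terms of [sigma] by [telescope]. *)
Lemma sigma_excess : ((sigma e r).-1 = \sum_(u | toward u r) (excess u).+1)%N.
Proof.
rewrite sum_excessS -deg_root // /sigma add1n /= (bigD1 r) ?eqxx //=.
rewrite dist_root muln1 addnC; congr (_ + _)%N.
apply/eqP; rewrite -(eqn_pmul2l (isT : 0 < 2)%N); apply/eqP.
rewrite (telescope tree_e excess_rec) big_distrr /=.
rewrite big_mkcond [RHS]big_mkcond; apply: eq_bigr => v _.
case: (v =P r) => //= _; case: (1 < deg e v)%N => //.
exact: mulnA.
Qed.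

(** By induction on the distance to [r].  If the score at the parent [p] is 0,
    everything that [p] receives from elsewhere than [v] amounts to the demand
    of [v], so the message from [p] to [v] is [F] of that demand. *)
Lemma extremal_score0 v : score e C v = 0.
Proof.
have [n] := ubnP (dist e r v); elim: n v => // n IHn v lt_n.
rewrite extremal_score; have [->|vr] := eqVneq v r.
  rewrite (eq_bigl (fun u => toward u r)) => [|u]; last by rewrite toward_root.
  by rewrite sum_message_up extremal_root sigma_excess subrr.
have [p vp dist_v] := toward_ex tree_e vr.
have evp := toward_edge vp; have epv : e p v by rewrite (edge_sym tree_e).
have : score e C p = 0 by apply: IHn; rewrite dist_v in lt_n.
rewrite extremal_score (bigD1 v) //= (message_upE vp) addrCA.
move/eqP; rewrite addr_eq0 eqr_opp => /eqP inflow_p.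
rewrite (bigD1 p) //= (extremal_message epv) -inflow_p.
rewrite (eq_bigl (fun u => toward u v)) => [|u]; last first.
  by rewrite (toward_children tree_e u vp).
rewrite sum_message_up extremal_off //.
have [deg1|deg_neq1] := eqVneq (deg e v) 1%N.
  by rewrite (excess_leaf vp deg1) big1 // => u; rewrite (toward_leaf _ vp).
by rewrite (excess_inner vp deg_neq1) F_odd add0r subrr.
Qed.

End ExtremalConfiguration.

Theorem corollary4p2 (T : finType) (e : rel T)
    (tree_e : is_tree e) (card_T : 2 <= #|T|) :
  exists C : config T,
    [/\ ~ stackable e C,
        mass C = estim e - 1
      & forall v : T, score e C v = 0%R].
Proof.
have [r estimE] : {r | estim e = E e r} by apply: eq_bigmax; apply: ltnW.
have score0 := extremal_score0 tree_e card_T r.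
exists (extremal e r); split; last exact: score0.
  by apply: nonstackable => // v; rewrite score0.
by rewrite mass_extremal estimE.
Qed.
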